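(* Under the $\cdot$ product, $\mathcal F$ is a free algebra on countably many generators. There are two natural sets of generators $\{1,\mathbf d,\mathbf d^{2},\cdots \}$ and $\{1,\mathbf c^{2},\mathbf c^{4},\cdots \}$.
   Context: Let $\mathcal F = k\langle \mathbf c,\mathbf d\rangle$ ($k$ a field of characteristic 0, $\deg\mathbf c=1$, $\deg\mathbf d=2$) and $\hat{\mathcal F}=ke\oplus\mathcal F$ with $e$ a formal symbol of degree $-1$. Define $\Delta$ on $\mathcal F$ by $\Delta(1)=0$, $\Delta(\mathbf c)=2(1\otimes1)$, $\Delta(\mathbf d)=1\otimes\mathbf c+\mathbf c\otimes1$, $\Delta(uv)=\Delta(u)v+u\Delta(v)$ (concatenation product), and $\hat\Delta(e)=e\otimes e$, $\hat\Delta(u)=\Delta(u)+e\otimes u+u\otimes e$. The product $\cdot$ on $\hat{\mathcal F}$ is the transpose of $\hat\Delta$ with respect to the monomial basis: the coefficient of $w$ in $u\cdot v$ equals the coefficient of $u\otimes v$ in $\hat\Delta(w)$; it is associative with unit $e$ and of degree $+1$. Explicitly it is determined by $1\cdot1=2\mathbf c$, $1\cdot\mathbf c=\mathbf c\cdot1=\mathbf d+2\mathbf c^2$, $1\cdot\mathbf d=2\mathbf c\mathbf d$, $\mathbf d\cdot1=2\mathbf d\mathbf c$, $\mathbf c\cdot\mathbf c=\mathbf d\mathbf c+\mathbf c\mathbf d+2\mathbf c^3$, $\mathbf c\cdot\mathbf d=\mathbf d^2+2\mathbf c^2\mathbf d$, $\mathbf d\cdot\mathbf c=\mathbf d^2+2\mathbf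 d\mathbf c^2$, $\mathbf d\cdot\mathbf d=2\mathbf d\mathbf c\mathbf d$, and the rule $(u\epsilon_1)\cdot(\epsilon_2 v)=u(\epsilon_1\cdot\epsilon_2)v$ for letters $\epsilon_1,\epsilon_2\in\{\mathbf c,\mathbf d\}$ and monomials $u,v$. *)

(* Defs.v *)
From HB Require Import structures.
From mathcomp Require Import all_boot all_algebra.
From mathcomp Require Import finmap.
From mathcomp.multinomials Require Import monalg.

Set Implicit Arguments.
Unset Strict Implicit.
Unset Printing Implicit Defensive.

Import GRing.Theory.
Local Open Scope ring_scope.

(* A nonunital associative algebra over k is a k-module with an associative
   bilinear product. *)
Definition assoc_algebra (k : fieldType) (A : lmodType k) (m : A -> A -> A) :=
  [/\ associative m, forall a, linear (m a) & forall b, linear (m^~ b)].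

Definition algebra_morphism (k : fieldType) (A B : lmodType k)
    (mA : A -> A -> A) (mB : B -> B -> B) (f : A -> B) :=
  linear f /\ {morph f : x y / mA x y >-> mB x y}.

(* (A, mA) is the free nonunital associative k-algebra on the family g. *)
Definition free_algebra_on (k : fieldType) (A : lmodType k)
    (mA : A -> A -> A) (I : Type) (g : I -> A) : Prop :=
  assoc_algebra mA /\
  forall (B : lmodType k) (mB : B -> B -> B), assoc_algebra mB ->
  forall f : I -> B,
  exists phi : A -> B,
    [/\ algebra_morphism mA mB phi, forall i, phi (g i) = f i
      & forall psi : A -> B, algebra_morphism mA mB psi ->
          (forall i, psi (g i) = f i) -> psi =1 phi].

Variant letter := Lc | Ld.

Definition letter_bool (x : letter) := if x is Lc then false else true.
Definition bool_letter (b : bool) := if b then Ld else Lc.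
Lemma letter_boolK : cancel letter_bool bool_letter. Proof. by case. Qed.
HB.instance Definition _ := Finite.copy letter (can_type letter_boolK).

(* Monomials in c, d; the element 1 of F is the empty word. *)
Notation word := {fmonom letter}.
(* Monomial basis of hat F; None is the formal symbol e. *)
Notation hword := (option word).

(* F, with its concatenation product as the library ring product; the tensor
   squares of F and of hat F are the free modules on pairs of monomials. *)
Notation cdF k := {malg k[word]}.
Notation cdFF k := {malg k[(word * word)%type]}.
Notation hatF k := {malg k[hword]}.
Notation hatFF k := {malg k[(hword * hword)%type]}.

Section CoProduct.
Variable k : fieldType.

Definition linext (K : choiceType) (V : lmodType k) (h : K -> V)
  (g : {malg k[K]}) : V := \sum_(m <- msupp g) g@_m *: h m.

Lemma malg_scaleU (K : choiceType) (a : k) (x : K) :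
  << a *g x >> = a *: << x >> :> {malg k[K]}.
Proof. by apply/malgP => y; rewrite mcoeffZ !mcoeffU mulrnAr mulr1. Qed.

Lemma linextEw (K : choiceType) (V : lmodType k) (h : K -> V)
    (D : {fset K}) (g : {malg k[K]}) :
  {subset msupp g <= D} -> linext h g = \sum_(m <- D) g@_m *: h m.
Proof.
move=> /fsubsetP sD; rewrite /linext; apply: (big_fset_incl _ sD) => /=.
by move=> x _ xN; rewrite /= (mcoeff_outdom xN) scale0r.
Qed.

Lemma linext_is_linear (K : choiceType) (V : lmodType k) (h : K -> V) :
  linear (linext h).
Proof.
move=> a x y; pose D := (msupp x `|` msupp y `|` msupp (a *: x + y))%fset.
rewrite !(@linextEw _ _ _ D);
  try by move=> z zx; rewrite !in_fsetU zx ?orbT.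
rewrite scaler_sumr -big_split /=; apply: eq_bigr => m _.
by rewrite mcoeffD mcoeffZ scalerDl scalerA.
Qed.

HB.instance Definition _ (K : choiceType) (V : lmodType k) (h : K -> V) :=
  GRing.isLinear.Build k {malg k[K]} V *:%R (linext h) (linext_is_linear h).

Lemma linextU (K : choiceType) (V : lmodType k) (h : K -> V) (x : K) :
  linext h << x >> = h x.
Proof. by rewrite /linext msuppU oner_eq0 big_seq_fset1 mcoeffUU scale1r. Qed.

Lemma malg_lin_eq (K : choiceType) (V : lmodType k)
    (f g : {malg k[K]} -> V) :
  linear f -> linear g -> (forall x, f << x >> = g << x >>) -> f =1 g.
Proof.
move=> lf lg fg x.
pose F := HB.pack_for {linear {malg k[K]} -> V} f (GRing.isLinear.Build _ _ _ _ f lf).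
pose G := HB.pack_for {linear {malg k[K]} -> V} g (GRing.isLinear.Build _ _ _ _ g lg).
rewrite -[f]/(F : _ -> _) -[g]/(G : _ -> _) (monalgE x) !linear_sum.
by apply: eq_bigr => m _; rewrite malg_scaleU !linearZ /= fg.
Qed.

Lemma linext_linearl (K : choiceType) (U V : lmodType k)
    (h : U -> K -> V) (g : {malg k[K]}) :
  (forall x, linear (h^~ x)) -> linear (fun u => linext (h u) g).
Proof.
move=> lh a x y; rewrite /linext scaler_sumr -big_split /=.
apply: eq_bigr => m _.
by rewrite lh scalerDr !scalerA mulrC.
Qed.

Lemma linext_supp (K L : choiceType) (h : K -> {malg k[L]})
    (g : {malg k[K]}) (y : L) :
  (linext h g)@_y != 0 -> exists m, g@_m != 0 /\ (h m)@_y != 0.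
Proof.
rewrite /linext raddf_sum /= => nz.
have /hasP[m _ /=] : has (fun m => (g@_m *: h m)@_y != 0) (msupp g).
  apply: contraNT nz => /hasPn z; rewrite big_seq big1 // => m /z.
  by rewrite negbK => /eqP.
by rewrite mcoeffZ mulf_eq0 negb_or => /andP[]; exists m.
Qed.

Lemma mcoeffU_neq0 (L : choiceType) (x y : L) :
  (<< x >> : {malg k[L]})@_y != 0 -> x = y.
Proof. by rewrite mcoeffU; case: (x =P y) => [//|_]; rewrite mulr0n eqxx. Qed.

(* Keeps failing unifications from unfolding the library. *)
#[local] Opaque mkmalgU linext.

Definition cc : cdF k := << fmu Lc >>.
Definition dd : cdF k := << fmu Ld >>.

Definition tensor (K L : choiceType) (u : {malg k[K]}) (v : {malg k[L]}) :
    {malg k[(K * L)%type]} :=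
  linext (fun a => linext (fun b => << (a, b) >>) v) u.

(* The F-bimodule structure u (a (x) b) = ua (x) b, (a (x) b) v = a (x) bv. *)
Definition lact (u : cdF k) (t : cdFF k) : cdFF k :=
  linext (fun p => tensor (u * << p.1 >>) << p.2 >>) t.
Definition ract (t : cdFF k) (v : cdF k) : cdFF k :=
  linext (fun p => tensor << p.1 >> (<< p.2 >> * v)) t.

Lemma tensorU (K L : choiceType) (a : K) (b : L) :
  tensor << a >> << b >> = << (a, b) >>.
Proof. by rewrite /tensor !linextU. Qed.

Lemma tensor_linearl (K L : choiceType) (v : {malg k[L]}) :
  linear ((@tensor K L)^~ v).
Proof. exact: linext_is_linear. Qed.

Lemma tensor_linearr (K L : choiceType) (u : {malg k[K]}) :
  linear (@tensor K L u).
Proof. by apply: linext_linearl => a; apply: linext_is_linear. Qed.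

Lemma malgUM (K : monomType) (a b : K) :
  << a >> * << b >> = << mmul a b >> :> {malg k[K]}.
Proof. by rewrite malgM_def fgmulUU mulr1. Qed.

Lemma lactU (u a b : word) : lact << u >> << (a, b) >> = << (mmul u a, b) >>.
Proof. by rewrite /lact linextU /= malgUM tensorU. Qed.

Lemma ractU (v a b : word) : ract << (a, b) >> << v >> = << (a, mmul b v) >>.
Proof. by rewrite /ract linextU /= malgUM tensorU. Qed.

Lemma lact_linearr (u : cdF k) : linear (lact u).
Proof. exact: linext_is_linear. Qed.

Lemma lactD (u : cdF k) x y : lact u (x + y) = lact u x + lact u y.
Proof. exact: linearD. Qed.

Lemma lact_linearl (t : cdFF k) : linear (lact^~ t).
Proof.
apply: linext_linearl => p a x y.
by rewrite mulrDl -scalerAl tensor_linearl.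
Qed.

Lemma ract_linearl (v : cdF k) : linear (ract^~ v).
Proof. exact: linext_is_linear. Qed.

Lemma ractD (v : cdF k) x y : ract (x + y) v = ract x v + ract y v.
Proof. exact: linearD. Qed.

Lemma malg_scaleAr (K : monomType) (a : k) (x y : {malg k[K]}) :
  x * (a *: y) = a *: (x * y).
Proof.
have lin_l (z : {malg k[K]}) : linear (fun x => x * z).
  by move=> b u v; rewrite mulrDl scalerAl.
move: x; apply: malg_lin_eq; first exact: lin_l.
  by move=> b u v; rewrite mulrDl -scalerAl scalerDr !scalerA mulrC.
move=> x; rewrite !malgM_def !fgmulUg scaler_sumr.
rewrite (big_fset_incl _ (B := msupp y)) ?msuppZ_le //=.
  by apply: eq_bigr => m _; rewrite !mul1r mcoeffZ malg_scaleU -scalerA -malg_scaleU.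
by move=> z _ /mcoeff_outdom ->; rewrite mulr0 monalgU0.
Qed.

Lemma ract_linearr (t : cdFF k) : linear (ract t).
Proof.
apply: linext_linearl => p a x y.
by rewrite mulrDr malg_scaleAr tensor_linearr.
Qed.

Definition Delta_letter (x : letter) : cdFF k :=
  match x with
  | Lc => 2%:R *: tensor 1 1
  | Ld => tensor 1 cc + tensor cc 1
  end.

Fixpoint Delta_word (s : seq letter) : cdFF k :=
  if s is x :: s' then
    ract (Delta_letter x) << FMonom s' >> + lact << fmu x >> (Delta_word s')
  else 0.

Definition Delta : cdF k -> cdFF k := linext (fun w : word => Delta_word w).

Lemma Delta_linear : linear Delta.
Proof. exact: linext_is_linear. Qed.

Lemma DeltaU (w : word) : Delta << w >> = Delta_word w.
Proof. exact: linextU. Qed.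

Lemma Delta1 : Delta 1 = 0.
Proof. by rewrite /Delta linextU fm1. Qed.

Lemma fmE1 (s : seq letter) (x : letter) :
  FMonom (x :: s) = mmul (fmu x) (FMonom s).
Proof. by apply/val_inj; rewrite /= fmM fmU. Qed.

Lemma fmone_nil : FMonom [::] = mone :> word.
Proof. by apply/val_inj; rewrite /= fm1. Qed.

Lemma Delta_fmu x : Delta << fmu x >> = Delta_letter x.
Proof.
rewrite /Delta linextU fmU /= fmone_nil.
have -> : lact << fmu x >> 0 = 0 by rewrite /lact linear0.
rewrite addr0.
move: (Delta_letter x); apply: malg_lin_eq => //; first exact: ract_linearl.
by case=> a b; rewrite ractU mulm1.
Qed.

Lemma Delta_cons x (w : word) : Delta << mmul (fmu x) w >> =
  ract (Delta_letter x) << w >> + lact << fmu x >> (Delta << w >>).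
Proof.
by case: w => s; rewrite -fmE1 (DeltaU (FMonom (x :: s))) (DeltaU (FMonom s)).
Qed.

Lemma Deltac : Delta cc = 2%:R *: tensor 1 1.
Proof. exact: Delta_fmu. Qed.

Lemma Deltad : Delta dd = tensor 1 cc + tensor cc 1.
Proof. exact: Delta_fmu. Qed.

Lemma lactA (u v : word) t :
  lact << u >> (lact << v >> t) = lact << mmul u v >> t.
Proof.
move: t; apply: malg_lin_eq; try exact: lact_linearr.
  by move=> a x y; rewrite !lact_linearr.
by case=> a b; rewrite !lactU mulmA.
Qed.

Lemma ractA (u v : word) t :
  ract (ract t << u >>) << v >> = ract t << mmul u v >>.
Proof.
move: t; apply: malg_lin_eq; try exact: ract_linearl.
  by move=> a x y; rewrite !ract_linearl.
by case=> a b; rewrite !ractU mulmA.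
Qed.

Lemma lract (u v : word) t :
  ract (lact << u >> t) << v >> = lact << u >> (ract t << v >>).
Proof.
move: t; apply: malg_lin_eq.
- by move=> a x y; rewrite lact_linearr ract_linearl.
- by move=> a x y; rewrite ract_linearl lact_linearr.
by case=> a b; rewrite lactU !ractU lactU.
Qed.

Lemma lact1 t : lact 1 t = t.
Proof.
move: t; apply: malg_lin_eq => //; first exact: lact_linearr.
by case=> a b; rewrite lactU mul1m.
Qed.

#[local] Opaque Delta lact ract.

Lemma DeltaM u v : Delta (u * v) = ract (Delta u) v + lact u (Delta v).
Proof.
move: u; apply: malg_lin_eq.
- by move=> a x y; rewrite mulrDl -scalerAl Delta_linear.
- move=> a x y; rewrite Delta_linear ract_linearl lact_linearl scalerDr.
  by rewrite addrACA.
move=> u; move: v; apply: malg_lin_eq.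
- by move=> a x y; rewrite mulrDr malg_scaleAr Delta_linear.
- move=> a x y; rewrite Delta_linear ract_linearr lact_linearr scalerDr.
  by rewrite addrACA.
move=> v; rewrite malgUM; case: u; elim=> [|x s].
  rewrite fmone_nil [X in _ = _ + X]lact1 [Delta << mone >>]Delta1 mul1m.
  by rewrite [ract 0 _]linear0 add0r.
rewrite fmE1; move: (FMonom s) => {}s IH.
rewrite -mulmA [LHS]Delta_cons IH [X in _ = ract X _ + _]Delta_cons.
rewrite [X in _ + X = _]lactD [X in _ = X + _]ractD [LHS]addrA.
by rewrite [X in _ = X + _ + _]ractA [X in _ = _ + X + _]lract
   [X in _ + X = _]lactA; reflexivity.
Qed.

Definition hate : hatF k := << None >>.
Definition to_hat : cdF k -> hatF k := linext (fun w => << Some w >>).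
Definition to_hat2 : cdFF k -> hatFF k :=
  linext (fun p => << (Some p.1, Some p.2) >>).

Definition hatDelta : hatF k -> hatFF k :=
  linext (fun x : hword =>
    if x is Some w then
      to_hat2 (Delta << w >>)
      + tensor hate (to_hat << w >>) + tensor (to_hat << w >>) hate
    else tensor hate hate).

Lemma hatDelta_e : hatDelta hate = tensor hate hate.
Proof. exact: linextU. Qed.

Lemma hatDelta_F u : hatDelta (to_hat u) =
  to_hat2 (Delta u) + tensor hate (to_hat u) + tensor (to_hat u) hate.
Proof.
have lh := linext_is_linear.
move: u; apply: malg_lin_eq.
- by move=> a x y; rewrite /to_hat lh /hatDelta lh.
- move=> a x y; rewrite Delta_linear /to_hat2 /to_hat !lh.
  rewrite tensor_linearl tensor_linearr !scalerDr.
  by rewrite [X in X + _ = _]addrACA [LHS]addrACA.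
by move=> w; rewrite {1}/to_hat linextU /hatDelta linextU.
Qed.

Definition hsize (x : hword) : nat := if x is Some w then size w else 0.

(* u . v = \sum_w [u (x) v](hatDelta w) w.  Only words w with at most
   |u| + |v| + 1 letters can contribute, so the sum may be truncated there;
   see hat_dotE. *)
Definition hat_dot_basis (u v : hword) : hatF k :=
  \sum_(w : option ((hsize u + hsize v).+1.-bseq letter))
    let w' : hword := omap (fun s : (_.-bseq letter) => FMonom s) w in
    (hatDelta << w' >>)@_(u, v) *: << w' >>.

Definition hat_dot (x y : hatF k) : hatF k :=
  linext (fun u => linext (fun v => hat_dot_basis u v) y) x.

Definition of_hat : hatF k -> cdF k :=
  linext (fun x : hword => if x is Some w then << w >> else 0).

(* The restriction of the product of hat F to F; see to_hat_dot. *)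
Definition dot (u v : cdF k) : cdF k := of_hat (hat_dot (to_hat u) (to_hat v)).

Lemma hat_dotU u v : hat_dot << u >> << v >> = hat_dot_basis u v.
Proof. by rewrite /hat_dot linextU linextU. Qed.

Lemma mcoeffD_neq0 (L : choiceType) (x y : {malg k[L]}) z :
  (x + y)@_z != 0 -> x@_z != 0 \/ y@_z != 0.
Proof.
rewrite mcoeffD => nz; apply/orP; apply: contraNT nz.
by rewrite negb_or !negbK => /andP[/eqP -> /eqP ->]; rewrite addr0.
Qed.

#[local] Transparent lact ract.

Lemma Delta_word_supp s (u v : word) :
  (Delta_word s)@_(u, v) != 0 -> (size s <= (size u + size v).+1)%N.
Proof.
elim: s u v => [|x s IH] u v; first by rewrite /= mcoeff0 eqxx.
rewrite [Delta_word _]/= => /mcoeffD_neq0[] /linext_supp[[a b] [nz]] /=;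
  rewrite malgUM tensorU => /mcoeffU_neq0[<- <-]; rewrite fmM.
  by rewrite size_cat ltnS addnA leq_addl.
by rewrite fmU /= addSn ltnS IH.
Qed.

Lemma to_hatU w : to_hat << w >> = << Some w >>.
Proof. exact: linextU. Qed.

Lemma hatDelta_supp (w u v : hword) :
  (hatDelta << w >>)@_(u, v) != 0 -> (hsize w <= (hsize u + hsize v).+1)%N.
Proof.
rewrite /hatDelta linextU; case: w => [w|//].
rewrite to_hatU !tensorU DeltaU.
move=> /mcoeffD_neq0[/mcoeffD_neq0[]|].
- case/linext_supp=> -[a b] /= [nz] /mcoeffU_neq0[<- <-].
  exact: Delta_word_supp nz.
- by case/mcoeffU_neq0 => <- <- /=.
by case/mcoeffU_neq0 => <- <- /=; rewrite addn0.
Qed.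

(* The product is the transpose of hatDelta. *)
Lemma hat_dotE u v w :
  (hat_dot << u >> << v >>)@_w = (hatDelta << w >>)@_(u, v).
Proof.
rewrite hat_dotU /hat_dot_basis raddf_sum /=.
under eq_bigr => x _ do rewrite mcoeffZ mcoeffU.
have [z|/hatDelta_supp sw] := eqVneq ((hatDelta << w >>)@_(u, v)) 0.
  rewrite z big1 // => x _; case: eqP => [->|]; last by rewrite mulr0.
  by rewrite z mul0r.
pose x0 : option ((hsize u + hsize v).+1.-bseq letter) :=
  if w is Some w' then Some (insub_bseq _ w') else None.
have x0E : omap (fun t : (_.-bseq letter) => FMonom t) x0 = w.
  rewrite /x0; case: w sw {x0} => //= w sw; congr Some.
  by apply/val_inj; rewrite /= insubdK.
rewrite (bigD1 x0) //= x0E eqxx mulr1 big1 ?addr0 // => x xN.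
case: eqP => [xw|]; last by rewrite mulr0.
case/eqP: xN; move: xw; rewrite -x0E.
by case: x => [x|]; case: (x0) => [y|] //= [/val_inj ->].
Qed.

Lemma of_hatK x : x@_None = 0 -> to_hat (of_hat x) = x.
Proof.
have E y : to_hat (of_hat y) = y - y@_None *: hate.
  move: y; apply: malg_lin_eq.
  - by move=> a y z; rewrite /of_hat linext_is_linear /to_hat linext_is_linear.
  - move=> a y z; rewrite mcoeffD mcoeffZ scalerDl scalerBr scalerA opprD.
    by rewrite [LHS]addrACA.
  case=> [w|]; rewrite /of_hat linextU mcoeffU.
    by rewrite to_hatU scale0r subr0.
  by rewrite [to_hat 0]linear0 scale1r subrr.
by move=> x0; rewrite E x0 scale0r subr0.
Qed.

Lemma hat_dot_linearl y : linear (hat_dot^~ y).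
Proof. exact: linext_is_linear. Qed.

Lemma hat_dot_linearr x : linear (hat_dot x).
Proof. by apply: linext_linearl => m; exact: linext_is_linear. Qed.

Lemma to_hat_dot u v : to_hat (dot u v) = hat_dot (to_hat u) (to_hat v).
Proof.
rewrite /dot of_hatK //.
have l0 : linear (fun _ : cdF k => 0 : k^o).
  by move=> a y z; rewrite scaler0 addr0.
apply: (@malg_lin_eq _ k^o (fun u => (hat_dot (to_hat u) _)@_None) _ _ l0).
  move=> a x y; rewrite /to_hat linext_is_linear hat_dot_linearl.
  by rewrite mcoeffD mcoeffZ.
move=> {}u.
apply: (@malg_lin_eq _ k^o (fun v => (hat_dot _ (to_hat v))@_None) _ _ l0).
  move=> a x y; rewrite {2}/to_hat linext_is_linear hat_dot_linearr.
  by rewrite mcoeffD mcoeffZ.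
move=> {}v; rewrite !to_hatU hat_dotE hatDelta_e tensorU mcoeffU.
by case: eqP.
Qed.

End CoProduct.

Arguments cc {k}.
Arguments dd {k}.
Arguments hate {k}.

(* Main.v *)
Require Import Defs.
From HB Require Import structures.
From mathcomp Require Import all_boot all_algebra.
From mathcomp.multinomials Require Import monalg.
Import GRing.Theory.
Local Open Scope ring_scope.

(* Write [l] (resp. [r]) for the linear map stripping a leading (resp. trailing)
   [c] from a monomial and killing the monomials without one.  The product is
     u . v = 2 u c v + u d l(v) + r(u) d v,
   and its associativity follows from l(uv) = l(u) v + eps(u) l(v), the mirror
   rule for [r], and l r = r l, where [eps] is the coefficient of [1].

   In particular  d^n . v = 2 d^n c v + d^(n+1) l(v).  Since every monomial is
   [d^n] or [d^n c v], this relation determines, by recursion on the monomial,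
   a morphism with prescribed values on the powers of [d].

   It also gives  d^j c^(2i+2) = - 1/2 d^(j+1) c^(2i)  modulo products, whence
   c^(2n) = (-1/2)^n d^n  modulo the subalgebra generated by the [d^i], [i < n].
   This triangular change of generators yields the second generating set. *)

Set Implicit Arguments.
Unset Strict Implicit.

(* Keeps failing unifications from unfolding the library; the locks on [coef],
   [coef2] and [lcons] below serve the same purpose. *)
#[local] Opaque mkmalgU mkmalg msupp mcoeff linext fgmul fgscale
  fgadd fgopp fgzero fgone.

Lemma nseqSr (T : Type) n (a : T) : nseq n.+1 a = rcons (nseq n a) a.
Proof. by elim: n => //= n <-. Qed.

Lemma linear_at0 (k : fieldType) (V W : lmodType k) (h : V -> W) :
  linear h -> h 0 = 0.
Proof.
by move=> hL; have := hL (-1) 0 0; rewrite scaler0 addr0 scaleN1r addNr.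
Qed.

(** * Associativity of a product built from two commuting stripping maps *)

Section StripProduct.
Variables (k : fieldType) (A : lalgType k).
Hypothesis scaleAr : forall (a : k) (x y : A), x * (a *: y) = a *: (x * y).
Variables (c d : A) (l r : {linear A -> A}) (e : A -> k).
Hypothesis lM : forall x y, l (x * y) = l x * y + e x *: l y.
Hypothesis rM : forall x y, r (x * y) = x * r y + e y *: r x.
Hypotheses (lc : l c = 1) (ld : l d = 0) (rc : r c = 1) (rd : r d = 0).
Hypotheses (ec : e c = 0) (ed : e d = 0) (lrC : forall x, l (r x) = r (l x)).

Definition strip_product (x y : A) : A :=
  (x * c * y) *+ 2 + x * d * l y + r x * d * y.

Local Notation "x ** y" := (strip_product x y) (at level 40).

Lemma strip_product_linearl y : linear (strip_product^~ y).
Proof.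
move=> a x z; rewrite /strip_product !mulr2n linearP !mulrDl -!scalerAl.
by rewrite !scalerDr (AC (2*2*2*2) ((1*3*5*7)*(2*4*6*8))).
Qed.

Lemma strip_product_linearr x : linear (strip_product x).
Proof.
move=> a y z; rewrite /strip_product !mulr2n linearP !mulrDr !scaleAr.
by rewrite !scalerDr (AC (2*2*2*2) ((1*3*5*7)*(2*4*6*8))).
Qed.

(** Only the term [r x * d * y] fails to be left linear for concatenation, and [rM] measures the
    defect. *)
Lemma strip_productMl x x' y :
  (x * x') ** y = x * (x' ** y) + e x' *: (r x * d * y).
Proof.
by rewrite /strip_product !mulr2n rM !mulrDl !mulrDr -!scalerAl !mulrA !addrA.
Qed.

(** [r] kills whatever ends in [d] and cancels a trailing [c]; the doubled term comes from
    [x * c * y], through the summand of [rM] that carries [e y]. *)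
Lemma rstrip_product x y : r (x ** y) = x ** r y + (e y *: x) *+ 2.
Proof.
have rxd z : r (z * d) = 0 by rewrite rM rd mulr0 ed scale0r addr0.
have rxc z : r (z * c) = z by rewrite rM rc mulr1 ec scale0r addr0.
rewrite /strip_product !mulr2n !raddfD /= !(rM (_ * _)).
by rewrite rxc !rxd !scaler0 !addr0 lrC (AC (2*2*1*1) ((1*3*5*6)*(2*4))).
Qed.

Lemma lstrip_product x y : l (x ** y) = l x ** y + (e x *: y) *+ 2.
Proof.
have ldx z : l (d * z) = 0 by rewrite lM ld mul0r ed scale0r addr0.
have lcx z : l (c * z) = z by rewrite lM lc mul1r ec scale0r addr0.
rewrite /strip_product !mulr2n -!mulrA !raddfD /= !(lM _ (_ * _)).
by rewrite lcx !ldx !scaler0 !addr0 lrC (AC (2*2*1*1) ((1*3*5*6)*(2*4))).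
Qed.

(** Both bracketings carry the extra term [2 e(y) x d z], from [lstrip_product] on one side and
    [rstrip_product] on the other; [lrC] matches the terms [x d l(r(y)) d z]. *)
Lemma strip_productA : associative strip_product.
Proof.
move=> x y z.
rewrite {1}/strip_product lstrip_product [RHS]/strip_product rstrip_product.
rewrite /strip_product lrC !mulr2n.
rewrite !mulrDl !mulrDr !scaleAr -!scalerAl !mulrA.
by rewrite (AC (4*4*(4*2)*4)
  ((1*2*9*15)*(5*6*10*16)*(3*7*11*17)*(4*8*12*18*(13*14)))).
Qed.

Lemma strip_product_rstrip0 x y :
  r x = 0 -> x ** y = (x * c * y) *+ 2 + x * d * l y.
Proof. by move=> rx0; rewrite /strip_product rx0 !mul0r addr0. Qed.

Lemma strip_product1x y : r 1 = 0 -> 1 ** y = (c * y) *+ 2 + d * l y.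
Proof. by move/strip_product_rstrip0->; rewrite !mul1r. Qed.
End StripProduct.

(** * Words, coefficients and the stripping maps on [F] *)

HB.lock Definition coef (k : fieldType) (s : seq letter) (x : cdF k) : k :=
  x@_(FMonom s).

HB.lock Definition coef2 (k : fieldType) (s t : seq letter) (T : cdFF k) : k :=
  T@_(FMonom s, FMonom t).

HB.lock Definition lcons (k : fieldType) (a : letter) (x : cdF k) : cdF k :=
  << fmu a >> * x.

Section ClosedForm.
Variable k : fieldType.
Implicit Types (s : seq letter) (u v w : word) (x y z : cdF k).

Definition cword s : cdF k := << FMonom s >>.

Definition cletter (a : letter) : cdF k := << fmu a >>.

Lemma coefD s x y : coef s (x + y) = coef s x + coef s y.
Proof. by rewrite unlock; exact: mcoeffD. Qed.

Lemma coef0 s : coef s (0 : cdF k) = 0.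
Proof. by rewrite unlock mcoeff0. Qed.

Lemma coefZ s (a : k) x : coef s (a *: x) = a * coef s x.
Proof. by rewrite unlock; exact: mcoeffZ. Qed.

Lemma coefMn s x n : coef s (x *+ n) = coef s x *+ n.
Proof. by rewrite unlock; exact: mcoeffMn. Qed.

Lemma coef_linear s : linear (coef s : cdF k -> k^o).
Proof. by move=> a x y; rewrite coefD coefZ. Qed.

Lemma coef2D s t (T T' : cdFF k) :
  coef2 s t (T + T') = coef2 s t T + coef2 s t T'.
Proof. by rewrite unlock; exact: mcoeffD. Qed.

Lemma coef2Z s t (a : k) (T : cdFF k) : coef2 s t (a *: T) = a * coef2 s t T.
Proof. by rewrite unlock; exact: mcoeffZ. Qed.

Lemma coef2_linear s t : linear (coef2 s t : cdFF k -> k^o).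
Proof. by move=> a x y; rewrite coef2D coef2Z. Qed.

Lemma coefP x y : (forall s, coef s x = coef s y) -> x = y.
Proof. by rewrite unlock => xy; apply/malgP => -[s]; exact: xy. Qed.

Definition lstrip : cdF k -> cdF k :=
  linext (fun w : word => if (w : seq letter) is Lc :: s then cword s else 0).

Definition rstrip : cdF k -> cdF k :=
  linext (fun w : word =>
    if rev (w : seq letter) is Lc :: s then cword (rev s) else 0).

Lemma lstrip_linear : linear lstrip.
Proof. exact: linext_is_linear. Qed.
HB.instance Definition _ :=
  GRing.isLinear.Build k (cdF k) (cdF k) *:%R lstrip lstrip_linear.

Lemma rstrip_linear : linear rstrip.
Proof. exact: linext_is_linear. Qed.
HB.instance Definition _ :=
  GRing.isLinear.Build k (cdF k) (cdF k) *:%R rstrip rstrip_linear.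

Lemma cwordE w : << w >> = cword w.
Proof. by case: w. Qed.

Lemma cword_nil : cword [::] = 1.
Proof. by rewrite /cword fmone_nil. Qed.

Lemma cword_cat s t : cword (s ++ t) = cword s * cword t.
Proof. by rewrite /cword malgUM; congr << _ >>; apply/val_inj; rewrite /= fmM. Qed.

Lemma cword1 a : cword [:: a] = cletter a.
Proof. by rewrite /cword fmE1 fmone_nil mulm1. Qed.

Lemma cword_cons a s : cword (a :: s) = cletter a * cword s.
Proof. by rewrite -cat1s cword_cat cword1. Qed.

Lemma lstrip_word s :
  lstrip (cword s) = if s is Lc :: t then cword t else 0.
Proof. exact: linextU. Qed.

Lemma rstrip_rcons s a :
  rstrip (cword (rcons s a)) = if a is Lc then cword s else 0.
Proof.
by rewrite /rstrip /cword linextU /= rev_rcons; case: a => //; rewrite revK.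
Qed.

Lemma rstrip_nil : rstrip (cword [::]) = 0.
Proof. exact: linextU. Qed.

Lemma rstrip1 : rstrip 1 = 0.
Proof. by rewrite -cword_nil rstrip_nil. Qed.

Lemma coef_word s t : coef s (cword t) = (t == s)%:R.
Proof. by rewrite unlock /cword mcoeffU. Qed.

Lemma coef2_word s t u v :
  coef2 s t (<< (u, v) >> : cdFF k) =
  ((u : seq letter) == s)%:R * ((v : seq letter) == t)%:R.
Proof. by rewrite unlock mcoeffU xpair_eqE -natrM mulnb. Qed.

Lemma mul_linearl (a : k) x z y : (a *: x + z) * y = a *: (x * y) + z * y.
Proof. by rewrite mulrDl scalerAl. Qed.

Lemma mul_linearr (a : k) x y z : x * (a *: y + z) = a *: (x * y) + x * z.
Proof. by rewrite mulrDr malg_scaleAr. Qed.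

(** A leading [c] of a product of words comes from the left factor, unless that factor is empty. *)
Lemma lstripM x y : lstrip (x * y) = lstrip x * y + coef [::] x *: lstrip y.
Proof.
move: x; apply: malg_lin_eq.
- by move=> a x z; rewrite mul_linearl lstrip_linear.
- move=> a x z; rewrite lstrip_linear mul_linearl coefD coefZ scalerDl.
  by rewrite scalerDr scalerA addrACA.
move=> u; move: y; apply: malg_lin_eq.
- by move=> a x z; rewrite mul_linearr lstrip_linear.
- move=> a x z; rewrite lstrip_linear mul_linearr.
  by rewrite !scalerDr !scalerA addrACA [_ * a]mulrC.
move=> v; rewrite !cwordE -cword_cat coef_word !lstrip_word.
case: (u : seq letter) => [|[] s] /=.
- by rewrite mul0r add0r scale1r.
- by rewrite scale0r addr0 cword_cat.
by rewrite mul0r scale0r addr0.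
Qed.

Lemma rstripM x y : rstrip (x * y) = x * rstrip y + coef [::] y *: rstrip x.
Proof.
move: x; apply: malg_lin_eq.
- by move=> a x z; rewrite mul_linearl rstrip_linear.
- move=> a x z; rewrite rstrip_linear mul_linearl.
  by rewrite !scalerDr !scalerA addrACA [_ * a]mulrC.
move=> u; move: y; apply: malg_lin_eq.
- by move=> a x z; rewrite mul_linearr rstrip_linear.
- move=> a x z; rewrite rstrip_linear mul_linearr coefD coefZ scalerDl.
  by rewrite scalerDr scalerA addrACA.
move=> v; rewrite !cwordE -cword_cat coef_word.
case/lastP: (v : seq letter) => [|s a].
  by rewrite cats0 rstrip_nil mulr0 add0r scale1r.
rewrite -rcons_cat !rstrip_rcons.
have -> : (rcons s a == [::]) = false by case: s.
by rewrite scale0r addr0; case: a; rewrite ?mulr0 // cword_cat.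
Qed.

Lemma lrstripC x : lstrip (rstrip x) = rstrip (lstrip x).
Proof.
move: x; apply: malg_lin_eq.
- by move=> a x y; rewrite rstrip_linear lstrip_linear.
- by move=> a x y; rewrite lstrip_linear rstrip_linear.
move=> w; rewrite cwordE; case/lastP: (w : seq letter) => [|s a].
  by rewrite rstrip_nil lstrip_word linear0 raddf0.
rewrite rstrip_rcons lstrip_word; case: s => [|b s] /=.
  by case: a; rewrite ?lstrip_word ?rstrip_nil ?raddf0.
by case: b; case: a; rewrite ?lstrip_word ?rstrip_rcons ?raddf0.
Qed.

Lemma lstrip_letter a : lstrip (cletter a) = (a == Lc)%:R.
Proof. by rewrite -cword1 lstrip_word; case: a => //; rewrite cword_nil. Qed.

Lemma rstrip_letter a : rstrip (cletter a) = (a == Lc)%:R.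
Proof. by rewrite -cword1 (@rstrip_rcons [::]); case: a => //; rewrite cword_nil. Qed.

Lemma coef_letter1 a : coef [::] (cletter a) = 0.
Proof. by rewrite -cword1 coef_word. Qed.

Lemma lcons_linear a : linear (@lcons k a).
Proof. by move=> b x y; rewrite unlock; exact: mul_linearr. Qed.

Lemma lcons_word a s : lcons a (cword s) = cword (a :: s).
Proof. by rewrite unlock cword_cons. Qed.

Lemma coef_lcons_nil a x : coef [::] (lcons a x) = 0.
Proof.
apply: (@malg_lin_eq _ _ k^o (fun x => coef [::] (lcons a x)) (fun=> 0)).
- by move=> b y z; rewrite lcons_linear coef_linear.
- by move=> b y z; rewrite scaler0 addr0.
by move=> w; rewrite cwordE lcons_word coef_word.
Qed.

Lemma coef_lcons a b s x :
  coef (b :: s) (lcons a x) = (a == b)%:R * coef s x.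
Proof.
apply: (@malg_lin_eq _ _ k^o (fun x => coef (b :: s) (lcons a x))
  (fun x => (a == b)%:R * coef s x)).
- by move=> c y z; rewrite lcons_linear coef_linear.
- by move=> c y z; rewrite coefD coefZ mulrDr /= [c *: _]mulrCA.
by move=> w; rewrite cwordE lcons_word !coef_word eqseq_cons -natrM mulnb.
Qed.

Lemma coef2_lact_nil a (T : cdFF k) t : coef2 [::] t (lact << fmu a >> T) = 0.
Proof.
apply: (@malg_lin_eq _ _ k^o (fun T => coef2 [::] t (lact << fmu a >> T))
  (fun=> 0)).
- by move=> b y z; rewrite lact_linearr coef2_linear.
- by move=> b y z; rewrite scaler0 addr0.
by case=> -[w] w'; rewrite lactU -fmE1 coef2_word mul0r.
Qed.

Lemma coef2_lact_cons a b s t (T : cdFF k) :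
  coef2 (b :: s) t (lact << fmu a >> T) = (a == b)%:R * coef2 s t T.
Proof.
apply: (@malg_lin_eq _ _ k^o (fun T => coef2 (b :: s) t (lact << fmu a >> T))
  (fun T => (a == b)%:R * coef2 s t T)).
- by move=> c y z; rewrite lact_linearr coef2_linear.
- by move=> c y z; rewrite coef2D coef2Z mulrDr /= [c *: _]mulrCA.
case=> -[w] w'; rewrite lactU -fmE1 !coef2_word /= eqseq_cons.
by rewrite -mulnb natrM mulrA.
Qed.

(** * Identification of [dot] with the closed formula *)

Definition xdot := strip_product cc dd lstrip rstrip.

(** Together with [xdot_nil], a recursion on the left factor that mirrors the derivation rule of
    [Delta]; the last term corresponds to [c (x) 1] in [Delta d]. *)
Lemma xdot_lcons a x y :
  xdot (lcons a x) y =
  lcons a (xdot x y) + (coef [::] x * (a == Lc)%:R) *: lcons Ld y.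
Proof.
have E : xdot (lcons a x) y =
    lcons a (xdot x y) + coef [::] x *: (rstrip (cletter a) * dd * y).
  by rewrite [@lcons]unlock; exact: strip_productMl rstripM _ _ _.
rewrite -scalerA E rstrip_letter; congr (_ + _ *: _).
rewrite [RHS]scaler_nat [@lcons]unlock.
by case: a {E}; rewrite ?mul1r // !mul0r.
Qed.

Lemma xdot_nil y :
  xdot (cword [::]) y = lcons Lc y *+ 2 + lcons Ld (lstrip y).
Proof.
by rewrite cword_nil unlock; apply: strip_product1x; exact: rstrip1.
Qed.

Lemma ractU_word s u t :
  ract << (u, FMonom t) >> (cword s) = << (u, FMonom (t ++ s)) >>.
Proof.
by rewrite /cword ractU; congr << (_, _) >>; apply/val_inj; rewrite /= fmM.
Qed.

Lemma ract_letter a s : ract (Delta_letter k a) (cword s) =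
  if a is Lc then 2%:R *: << (FMonom [::], FMonom s) >>
  else << (FMonom [::], FMonom (Lc :: s)) >>
       + << (FMonom [:: Lc], FMonom s) >>.
Proof.
have E1 : tensor 1 1 = << (FMonom [::], FMonom [::]) >> :> cdFF k.
  by rewrite fmone_nil; exact: tensorU.
have E2 : tensor 1 cc = << (FMonom [::], FMonom [:: Lc]) >> :> cdFF k.
  by rewrite fmE1 fmone_nil mulm1; exact: tensorU.
have E3 : tensor cc 1 = << (FMonom [:: Lc], FMonom [::]) >> :> cdFF k.
  by rewrite fmE1 fmone_nil mulm1; exact: tensorU.
case: a => /=.
  rewrite E1 -(ractU_word s _ [::]); exact: linearZ.
by rewrite E2 E3 -(ractU_word s _ [:: Lc]) -(ractU_word s _ [::]) ractD.
Qed.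

Lemma coef_Delta_word s t t' :
  coef2 t t' (Delta_word k s) = coef s (xdot (cword t) (cword t')).
Proof.
elim: s t => [|a s IH] t.
  have -> : coef2 t t' (Delta_word k [::]) = 0 by rewrite unlock mcoeff0.
  case: t => [|b t].
    by rewrite xdot_nil coefD coefMn !coef_lcons_nil mul0rn addr0.
  by rewrite -lcons_word xdot_lcons coefD coefZ !coef_lcons_nil mulr0 addr0.
rewrite [Delta_word _ _]/= coef2D -/(cword s) ract_letter.
(* [lact] prepends a letter, so only [Delta] of the first letter reaches an empty left tensor
   factor. *)
case: t => [|b t].
  rewrite coef2_lact_nil addr0 xdot_nil coefD coefMn !coef_lcons.
  rewrite lstrip_word; case: a => /=.
    rewrite mul0r addr0 mul1r coef2Z coef2_word coef_word eqxx mul1r.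
    by rewrite eq_sym mulr_natl.
  rewrite mul0r mul0rn add0r mul1r coef2D.
  rewrite [X in X + _]coef2_word [X in _ + X]coef2_word mul1r mul0r addr0.
  case: t' {IH} => [|[] t']; rewrite ?coef0 //.
  by rewrite coef_word /= eqseq_cons eqxx eq_sym.
rewrite coef2_lact_cons IH -lcons_word xdot_lcons coefD coefZ.
rewrite !coef_lcons addrC; congr (_ + _).
  by rewrite eq_sym.
rewrite !coef_word; case: a => /=.
  by rewrite coef2Z coef2_word !mul0r !mulr0.
(* Of the two terms of [Delta d], only [c (x) 1] has a nonempty left factor. *)
rewrite coef2D [X in X + _]coef2_word [X in _ + X]coef2_word mul0r add0r mul1r.
rewrite /= eqseq_cons -mulnb natrM mulrC [RHS]mulrC (eq_sym s) (eq_sym Lc).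
by rewrite (eq_sym [::]) (mulrC (b == Lc)%:R).
Qed.

Lemma coef_dot s t t' :
  coef s (dot (cword t) (cword t')) = coef2 t t' (Delta_word k s).
Proof.
have lh := linext_is_linear.
have E z : coef s z = (to_hat z)@_(Some (FMonom s)).
  move: z; apply: (@malg_lin_eq _ _ k^o (coef s)
    (fun z => (to_hat z)@_(Some (FMonom s)))).
  + exact: coef_linear.
  + by move=> a x z; rewrite /to_hat lh mcoeffD mcoeffZ.
  by move=> x; rewrite to_hatU mcoeffU unlock; exact: mcoeffU.
have E2 (T : cdFF k) :
    (to_hat2 T)@_(Some (FMonom t), Some (FMonom t')) = coef2 t t' T.
  move: T; apply: (@malg_lin_eq _ _ k^o
    (fun T => (to_hat2 T)@_(Some (FMonom t), Some (FMonom t'))) (coef2 t t')).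
  + by move=> a x z; rewrite /to_hat2 lh mcoeffD mcoeffZ.
  + exact: coef2_linear.
  by case=> a b; rewrite /to_hat2 linextU mcoeffU unlock; apply/esym/mcoeffU.
rewrite E to_hat_dot !to_hatU hat_dotE -to_hatU hatDelta_F to_hatU !tensorU.
(* At a pair of words, the two terms of [hatDelta] with a factor [e] have coefficient 0. *)
by rewrite !mcoeffD !mcoeffU !xpair_eqE /= andbF !addr0 DeltaU E2.
Qed.

Lemma dotE x y : dot x y = xdot x y.
Proof.
have lh := linext_is_linear.
move: x; apply: malg_lin_eq.
- by move=> a x z; rewrite /dot /to_hat lh hat_dot_linearl /of_hat lh.
- exact: strip_product_linearl.
move=> u; move: y; apply: malg_lin_eq.
- move=> a x z; rewrite /dot {2}/to_hat lh hat_dot_linearr.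
  by rewrite /of_hat lh.
- exact: strip_product_linearr (@malg_scaleAr _ _) _ _ _ _ _.
move=> v; apply: coefP => s.
by rewrite !cwordE coef_dot coef_Delta_word.
Qed.

Lemma dot_assoc_algebra : assoc_algebra (@dot k).
Proof.
have scaleAr (a : k) x y : x * (a *: y) = a *: (x * y) by exact: malg_scaleAr.
split.
- move=> x y z; rewrite !dotE.
  exact: (strip_productA scaleAr lstripM rstripM (lstrip_letter Lc)
    (lstrip_letter Ld) (rstrip_letter Lc) (rstrip_letter Ld) (coef_letter1 Lc)
    (coef_letter1 Ld) lrstripC).
- by move=> x a y z; rewrite !dotE; exact: strip_product_linearr.
by move=> x a y z; rewrite !dotE; exact: strip_product_linearl.
Qed.

Lemma rstrip_nseq_d n : rstrip (cword (nseq n Ld)) = 0.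
Proof.
by case: n => [|n]; rewrite ?rstrip_nil // nseqSr rstrip_rcons.
Qed.

(** The third term of [xdot] vanishes because [d^n] has no trailing [c]. With associativity and
    bilinearity, this formula is all that the freeness argument uses of the product. *)
Lemma dot_nseq_d n s : dot (cword (nseq n Ld)) (cword s) =
  2%:R *: cword (nseq n Ld ++ Lc :: s)
  + if s is Lc :: s' then cword (nseq n.+1 Ld ++ s') else 0.
Proof.
have E x y : rstrip x = 0 -> xdot x y =
    (x * cword [:: Lc] * y) *+ 2 + x * cword [:: Ld] * lstrip y.
  by move=> x0; rewrite !cword1; exact: strip_product_rstrip0.
rewrite dotE (E _ _ (rstrip_nseq_d n)) lstrip_word; congr (_ + _).
  by rewrite scaler_nat -(cat1s Lc s) catA 2!cword_cat.
case: s => [|[] s]; [exact: mulr0| |exact: mulr0].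
by rewrite nseqSr -cats1 2!cword_cat.
Qed.
End ClosedForm.

(** * Freeness of an algebra with a basis of words satisfying [mb] *)

Lemma free_algebra_on_eq (k : fieldType) (A : lmodType k) (m : A -> A -> A)
    (I : Type) (g g' : I -> A) :
  g =1 g' -> free_algebra_on m g -> free_algebra_on m g'.
Proof.
move=> gg' [mA free]; split=> // B mB aB f.
have [phi [phiM phig uniq]] := free B mB aB f.
exists phi; split=> // [i|psi psiM psig]; first by rewrite -gg'.
by apply: uniq => // i; rewrite gg'.
Qed.

Section FreeBasis.
Variables (k : fieldType) (A : lmodType k) (m : A -> A -> A).
Variable b : seq letter -> A.
Hypothesis two_neq0 : 2%:R != 0 :> k.
Hypothesis assocA : assoc_algebra m.
(** With [b_eq], this says that [b] is a basis; it is informative so that [lift] can extract the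
    extension. *)
Hypothesis b_ext : forall (B : lmodType k) (h : seq letter -> B),
  {phi : A -> B | linear phi & forall s, phi (b s) = h s}.
Hypothesis b_eq : forall (B : lmodType k) (phi psi : A -> B),
  linear phi -> linear psi -> (forall s, phi (b s) = psi (b s)) -> phi =1 psi.
Hypothesis mb : forall n s, m (b (nseq n Ld)) (b s) =
  2%:R *: b (nseq n Ld ++ Lc :: s)
  + if s is Lc :: s' then b (nseq n.+1 Ld ++ s') else 0.

(** The relation [mb] solved for its first term: the word reduces to a product of [d^n] with a
    shorter word, and to a word where [c c] has become [d]. *)
Lemma b_cons_c n s : b (nseq n Ld ++ Lc :: s) = 2%:R^-1 *:
  (m (b (nseq n Ld)) (b s)
   - if s is Lc :: s' then b (nseq n.+1 Ld ++ s') else 0).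
Proof. by rewrite mb addrK scalerA mulVf // scale1r. Qed.

(** The grading of [F], for which both terms on the right of [mb] have the same degree. *)
Definition cd_degree (s : seq letter) : nat :=
  sumn [seq if a is Lc then 1 else 2 | a <- s].

(* The words of degree less than [2 * N] lie in the subalgebra generated by
   the powers [d ^ n], [n < N]. *)
Lemma cd_word_ind (P : A -> Prop) (N : nat) :
  P 0 -> (forall a x y, P x -> P y -> P (a *: x + y)) ->
  (forall n, (n < N)%N -> P (b (nseq n Ld))) ->
  (forall n x, (n < N)%N -> P x -> P (m (b (nseq n Ld)) x)) ->
  forall s, (cd_degree s < N.*2)%N -> P (b s).
Proof.
move=> P0 PL Pd Pm.
(* Splitting off [d^n] lets it absorb the leading letters [d] of [s]; [t] bounds the length of [s],
   which drops at each reduction. *)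
suff H t : forall n s, (size s <= t)%N -> (cd_degree s + n.*2 < N.*2)%N ->
    P (b (nseq n Ld ++ s)).
  by move=> s sN; apply: (H (size s) 0%N); rewrite ?addn0.
elim: t => [|t IH] n [|a s] //=.
- by rewrite cats0 add0n ltn_double => _; exact: Pd.
- by rewrite cats0 add0n ltn_double => _; exact: Pd.
rewrite ltnS /cd_degree /= -/(cd_degree s) => st; case: a => dN; last first.
  rewrite -cat_rcons -nseqSr; apply: IH => //.
  by rewrite doubleS -addn2 addnA [(_ + 2)%N]addnC addnA.
have nN : (n < N)%N.
  by rewrite -ltn_double (leq_ltn_trans _ dN) // leq_addl.
rewrite b_cons_c -[_ *: _]addr0; apply/(PL) => //.
rewrite addrC -scaleN1r; apply/(PL); last first.
  apply: Pm => //; apply: (IH 0%N) => //.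
  rewrite addn0; apply: leq_ltn_trans dN; rewrite add1n addSn ltnW // ltnS.
  exact: leq_addr.
(* The second word trades [c c] for one [d], which keeps the degree and shortens [s]. *)
case: s st dN => [//|[] s st dN] //; apply: IH; first exact: ltnW.
by move: dN; rewrite /cd_degree /= -/(cd_degree s) doubleS !add1n !addSn !addnS.
Qed.

(** The elements where the two morphisms agree form a subspace stable under left multiplication by
    the [d^n] with [n < N]. *)
Lemma morphism_eq (B : lmodType k) (mB : B -> B -> B) (phi psi : A -> B) N :
  algebra_morphism m mB phi -> algebra_morphism m mB psi ->
  (forall n, (n < N)%N -> phi (b (nseq n Ld)) = psi (b (nseq n Ld))) ->
  forall s, (cd_degree s < N.*2)%N -> phi (b s) = psi (b s).
Proof.
move=> [phiL phiM] [psiL psiM] E.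
apply: (cd_word_ind (P := fun x => phi x = psi x)) => //.
- by rewrite !linear_at0.
- by move=> a x y xE yE; rewrite phiL psiL xE yE.
by move=> n x nN xE; rewrite phiM psiM xE E.
Qed.

Lemma morphism_eq_all (B : lmodType k) (mB : B -> B -> B) (phi psi : A -> B) :
  algebra_morphism m mB phi -> algebra_morphism m mB psi ->
  (forall n, phi (b (nseq n Ld)) = psi (b (nseq n Ld))) -> phi =1 psi.
Proof.
move=> phiA psiA E; apply: b_eq; [by case: phiA|by case: psiA|] => s.
apply: (morphism_eq (N := (cd_degree s).+1) phiA psiA) => //.
by rewrite -addnn addSn ltnS leq_addr.
Qed.

(** * Morphisms with prescribed values on the powers of [d] *)

Section Lift.
Variables (B : lmodType k) (mB : B -> B -> B).
Hypothesis assocB : assoc_algebra mB.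

(* [lift_word f n s] is the value at [d ^ n * s] of the morphism mapping each
   [d ^ i] to [f i]. *)
Fixpoint lift_word (f : nat -> B) (n : nat) (s : seq letter) : B :=
  match s with
  | [::] => f n
  | Ld :: s' => lift_word f n.+1 s'
  | Lc :: s' => 2%:R^-1 *: (mB (f n) (lift_word f 0 s')
      - if s' is Lc :: s'' then lift_word f n.+1 s'' else 0)
  end.

Definition lift f : A -> B := s2val (b_ext (lift_word f 0)).

Lemma lift_linear f : linear (lift f).
Proof. by rewrite /lift; case: b_ext. Qed.

Lemma liftE f n s : lift f (b (nseq n Ld ++ s)) = lift_word f n s.
Proof.
have -> : lift f (b (nseq n Ld ++ s)) = lift_word f 0 (nseq n Ld ++ s).
  by rewrite /lift; case: b_ext.
suff H i : lift_word f i (nseq n Ld ++ s) = lift_word f (n + i) s.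
  by rewrite H addn0.
by elim: n i => [|n IH] i //=; rewrite IH addnS.
Qed.

Lemma lift_d f n : lift f (b (nseq n Ld)) = f n.
Proof. by have := liftE f n [::]; rewrite cats0. Qed.

(** The [Lc] clause of [lift_word] is [b_cons_c] read in [B], so the correction term in [mb]
    cancels. *)
Lemma lift_md f n x : lift f (m (b (nseq n Ld)) x) = mB (f n) (lift f x).
Proof.
have [_ mL _] := assocA; have [_ mBL _] := assocB.
apply: (@b_eq _ (fun x => lift f (m (b (nseq n Ld)) x))
  (fun x => mB (f n) (lift f x))).
- by move=> a y z; rewrite mL lift_linear.
- by move=> a y z; rewrite lift_linear mBL.
move=> s /=; rewrite mb lift_linear liftE /= scalerA divff // scale1r.
have -> : lift f (if s is Lc :: s' then b (nseq n.+1 Ld ++ s') else 0) =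
    if s is Lc :: s'' then lift_word f n.+1 s'' else 0.
  have lift0 := linear_at0 (lift_linear f).
  by case: s => [|[] s] //; rewrite -liftE.
by rewrite subrK (liftE f 0).
Qed.

(** Induction on the left factor: powers of [d] are [lift_md], and associativity of both products
    passes from [x] to [d^n . x]. *)
Lemma lift_morphism f : algebra_morphism m mB (lift f).
Proof.
have fL := lift_linear f; split=> // x y.
have [mA _ mR] := assocA; have [mBA _ mBR] := assocB.
move: x; apply: (@b_eq _ (fun x => lift f (m x y))
  (fun x => mB (lift f x) (lift f y))).
- by move=> a x z; rewrite mR fL.
- by move=> a x z; rewrite fL mBR.
move=> s; move: {-1}(cd_degree s).+1 (leqnn (cd_degree s).+1) => N sN.
apply: (cd_word_ind
  (P := fun x => lift f (m x y) = mB (lift f x) (lift f y)) (N := N)).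
- by rewrite (linear_at0 (mR y)) (linear_at0 fL) (linear_at0 (mBR _)).
- by move=> a x z xE zE; rewrite mR !fL mBR xE zE.
- by move=> n _; rewrite lift_md lift_d.
- by move=> n x _ xE; rewrite -mA !lift_md xE mBA.
by rewrite (leq_trans sN) // -addnn leq_addr.
Qed.
End Lift.

Lemma free_on_d_powers : free_algebra_on m (fun n => b (nseq n Ld)).
Proof.
split=> // B mB aB f; exists (lift mB f); split.
- exact: lift_morphism.
- exact: lift_d.
move=> psi psiA psiE; apply: morphism_eq_all psiA (lift_morphism aB f) _ => n.
by rewrite psiE lift_d.
Qed.

(** Taking the difference of two morphisms plays the part of working modulo products: [d^j c^(2i+2)]
    behaves as [- 1/2 d^(j+1) c^(2i)], and iterating yields the power of [- 1/2]. *)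
Lemma morphism_sub_c (B : lmodType k) (mB : B -> B -> B) (phi psi : A -> B) N :
  algebra_morphism m mB phi -> algebra_morphism m mB psi ->
  (forall n, (n < N)%N -> phi (b (nseq n Ld)) = psi (b (nseq n Ld))) ->
  forall i j, (i + j)%N = N ->
  phi (b (nseq j Ld ++ nseq i.*2 Lc)) - psi (b (nseq j Ld ++ nseq i.*2 Lc)) =
  (- 2%:R^-1) ^+ i *: (phi (b (nseq N Ld)) - psi (b (nseq N Ld))).
Proof.
move=> phiA psiA E.
have [phiL phiM] := phiA; have [psiL psiM] := psiA.
elim=> [|i IH] j ijN; first by rewrite cats0 expr0 scale1r -ijN.
have jN : (j < N)%N by rewrite -ijN addSn ltnS leq_addl.
(* [c^(2i+1)] has degree below [2N], so it lies in the subalgebra where the two morphisms agree. *)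
have Eodd : phi (b (nseq i.*2.+1 Lc)) = psi (b (nseq i.*2.+1 Lc)).
  apply: (morphism_eq phiA psiA E).
  have -> : cd_degree (nseq i.*2.+1 Lc) = i.*2.+1.
    by rewrite /cd_degree map_nseq sumn_nseq mul1n.
  by rewrite -doubleS leq_double // -ijN addSn ltnS leq_addr.
have step (h : A -> B) : linear h -> {morph h : x y / m x y >-> mB x y} ->
    h (b (nseq j Ld ++ nseq i.+1.*2 Lc)) = 2%:R^-1 *:
    (mB (h (b (nseq j Ld))) (h (b (nseq i.*2.+1 Lc)))
     - h (b (nseq j.+1 Ld ++ nseq i.*2 Lc))).
  move=> hL hM.
  rewrite doubleS [nseq _.+2 _]/= b_cons_c /=.
  rewrite -[_ *: _]addr0 hL (linear_at0 hL) addr0; congr (_ *: _).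
  by rewrite addrC -scaleN1r hL hM scaleN1r addrC.
rewrite !step // E // Eodd -scalerBr opprB addrC addrA subrK.
by rewrite -opprB IH ?addnS // exprS -scalerA scalerN scaleNr.
Qed.

(** The change of generators is triangular with diagonal entries [(-1/2)^n], so prescribed values on
    the [c^(2n)] determine values on the [d^n] recursively, and [lift] extends these. *)
Lemma free_on_c_powers : free_algebra_on m (fun n => b (nseq n.*2 Lc)).
Proof.
split=> // B mB aB f.
pose unit_half n : k := (- 2%:R^-1) ^+ n.
have nz n : unit_half n != 0.
  by rewrite expf_neq0 // oppr_eq0 invr_eq0.
(* Values forced on the powers of d: each is determined by the previous ones
   through [morphism_sub_c]. *)
pose fix vals n : seq B :=
  if n is n'.+1 then
    let s := vals n' in
    rcons s ((unit_half n')^-1 *: (f n' - lift mB (nth 0 s) (b (nseq n'.*2 Lc))))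
  else [::].
have size_vals n : size (vals n) = n.
  by elim: n => [//|n IH] /=; rewrite size_rcons IH.
pose g n := nth 0 (vals n.+1) n.
have valsE n i : (i < n)%N -> nth 0 (vals n) i = g i.
  elim: n => [//|n IH]; rewrite ltnS leq_eqVlt => /orP[/eqP -> //|lin].
  by rewrite /= nth_rcons size_vals lin IH.
have gE n : lift mB g (b (nseq n.*2 Lc)) = f n.
  (* [h] agrees with [g] below [n] and vanishes from [n] on, by the default value of [nth]; [g n]
     was chosen to correct [lift mB h] at [c^(2n)]. *)
  pose h := nth 0 (vals n).
  have E i : (i < n)%N ->
      lift mB g (b (nseq i Ld)) = lift mB h (b (nseq i Ld)).
    by move=> lin; rewrite !lift_d /h valsE.
  have gA := lift_morphism aB g; have hA := lift_morphism aB h.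
  have /eqP := morphism_sub_c gA hA E (addn0 n).
  rewrite /= !lift_d subr_eq => /eqP ->.
  have -> : h n = 0 by rewrite /h nth_default // size_vals.
  rewrite subr0 {1}/g /= nth_rcons size_vals ltnn eqxx.
  by rewrite scalerA divff // scale1r subrK.
exists (lift mB g); split=> //; first exact: lift_morphism.
move=> psi psiA psiE; have gA := lift_morphism aB g.
apply: (morphism_eq_all psiA gA) => n.
(* Strong induction: once [psi] and the lift agree on the lower powers of [d], agreement at [c^(2n)]
   forces it at [d^n], the factor [(-1/2)^n] being nonzero. *)
have [N nN] := ubnP n; elim: N n nN => // N IH n nN.
have E i : (i < n)%N -> psi (b (nseq i Ld)) = lift mB g (b (nseq i Ld)).
  by move=> lin; apply: IH; exact: leq_trans lin nN.
have := morphism_sub_c psiA gA E (addn0 n); rewrite /= psiE gE subrr.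
move=> /esym/eqP; rewrite scaler_eq0 (negPf (nz n)) subr_eq0.
by move=> /eqP.
Qed.
End FreeBasis.

(** * The two generating sets of [F] *)

Lemma cword_nseq (k : fieldType) a n : cword k (nseq n a) = cletter k a ^+ n.
Proof.
elim: n => [|n IH]; first by rewrite expr0 cword_nil.
by rewrite exprS -IH -cword_cons.
Qed.

Theorem theoremD1 (k : fieldType) (chark0 : [pchar k] =i pred0) :
  free_algebra_on (@dot k) (fun n : nat => dd ^+ n)
  /\ free_algebra_on (@dot k) (fun n : nat => cc ^+ (2 * n)).
Proof.
have two_neq0 : 2%:R != 0 :> k by have := chark0 2%N; rewrite !inE /= => ->.
have ext (B : lmodType k) (h : seq letter -> B) :
    {phi : cdF k -> B | linear phi & forall s, phi (cword k s) = h s}.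
  exists (linext (fun w : word => h w)); first exact: linext_is_linear.
  by move=> s; exact: linextU.
have ext_eq (B : lmodType k) (phi psi : cdF k -> B) :
    linear phi -> linear psi ->
    (forall s, phi (cword k s) = psi (cword k s)) -> phi =1 psi.
  move=> phiL psiL E; apply: malg_lin_eq => // w.
  by rewrite cwordE; exact: E.
have assoc := dot_assoc_algebra k.
split.
  apply: free_algebra_on_eq (free_on_d_powers two_neq0 assoc ext ext_eq _).
    by move=> n; exact: cword_nseq.
  exact: dot_nseq_d.
apply: free_algebra_on_eq (free_on_c_powers two_neq0 assoc ext ext_eq _).
  by move=> n; rewrite mul2n; exact: cword_nseq.
exact: dot_nseq_d.
Qed.
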